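(* (a) For every $\alpha\in\mathbb{R}_{+}$, the seed function $\varphi_{\alpha}^{\mathrm{LOP}}:\mathbb{R}^{m}\times\mathbb{R}^{m}\to\mathbb{R}\cup\{\infty\}$ is bounded below, and $\varphi_{\alpha}^{\mathrm{LOP}}(\bm{u},\cdot)$ is proper and coercive for every $\bm{u}\in\mathbb{R}^{m}$. (b) For every $\alpha\in(0,1)$, the seed function $\varphi_{\alpha}^{\mathrm{TGV}}:\mathbb{R}^{m}\times\mathbb{R}^{m}\to\mathbb{R}\cup\{\infty\}$ is bounded below, and $\varphi_{\alpha}^{\mathrm{TGV}}(\bm{u},\cdot)$ is proper and coercive for every $\bm{u}\in\mathbb{R}^{m}$.
   Context: A function is proper if it is finite somewhere (values in $\mathbb{R}\cup\{\infty\}$), and coercive if it tends to $\infty$ as the norm of its argument tends to $\infty$. $\mathbb{R}_{+}=[0,\infty)$. LOP seed function: $\varphi_{\alpha}^{\mathrm{LOP}}(\bm{u},\bm{\sigma}):=\sum_{i=1}^{m}h(u_i,\sigma_i)+\iota_{B_1^{\alpha}}(\bm{D}\bm{\sigma})$, where $h:\mathbb{R}\times\mathbb{R}\to\mathbb{R}\cup\{\infty\}$ is $$h(u,\sigma):=\begin{cases}\frac{u^2}{2\sigma}+\frac{\sigma}{2},&\sigma>0;\\0,&u=0\text{ and }\sigma=0;\\\infty,&\text{otherwise},\end{cases}$$ $\iota_{B_1^{\alpha}}(\bm{\xi}):=0$ if $\|\bm{\xi}\|_1\le\alpha$ and $\infty$ otherwise for $\bm{\xi}\in\mathbb{R}^{p}$,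 and $\bm{D}\in\mathbb{R}^{p\times m}$ is the first-order discrete difference operator $\bm{D}\bm{\sigma}:=(\sigma_{i_1}-\sigma_{i_2})_{(i_1,i_2)\in\mathcal{I}}$, with $\mathcal{I}$ the given set of indices of neighboring pairs in $\{1,\ldots,m\}$ and $p=|\mathcal{I}|$. TGV seed function: $\varphi_{\alpha}^{\mathrm{TGV}}(\bm{u},\bm{\sigma}):=\alpha\|\bm{u}-\bm{\sigma}\|_{2,1}^{\mathcal{G}_1}+(1-\alpha)\|\tilde{\bm{D}}\bm{\sigma}\|_{2,1}^{\mathcal{G}_2}$, where $\tilde{\bm{D}}\in\mathbb{R}^{p\times m}$ is a given matrix (the symmetrized version of a first-order discrete difference operator $\bm{D}\in\mathbb{R}^{m\times n}$), and $\mathcal{G}_1$, $\mathcal{G}_2$ are partitions of $\{1,\ldots,m\}$ and $\{1,\ldots,p\}$, respectively. For a partition $\mathcal{G}=(\mathcal{I}_k)_{k=1}^{K}$ of $\{1,\ldots,N\}$ into nonempty disjoint sets, $\|\bm{w}\|_{2,1}^{\mathcal{G}}:=\sum_{k=1}^{K}\sqrt{|\mathcal{I}_k|}\,\|\bm{w}_{\mathcal{I}_k}\|_2$, where $\bm{w}_{\mathcal{I}_k}=(w_i)_{i\in\mathcal{I}_k}$. *)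

(* Defs.v *)
From mathcomp Require Import all_boot all_order all_algebra.
From mathcomp Require Import all_classical all_reals all_analysis.

Set Implicit Arguments.
Unset Strict Implicit.
Unset Printing Implicit Defensive.

Import Order.TTheory GRing.Theory Num.Theory.
Import numFieldNormedType.Exports.

Local Open Scope classical_set_scope.
Local Open Scope ring_scope.

Section Norms.
Context {R : realType}.

(* The canonical norm on matrices in MathComp-Analysis is the max norm. *)
Definition norm1 n (x : 'cV[R]_n) : R := \sum_i `|x i 0|.

Definition norm2 n (x : 'cV[R]_n) : R := Num.sqrt (\sum_i x i 0 ^+ 2).

Definition subvec n (I : {set 'I_n}) (w : 'cV[R]_n) : 'cV[R]_#|I| :=
  rowsub (@enum_val _ (mem I)) w.

Definition group_norm n (G : {set {set 'I_n}}) (w : 'cV[R]_n) : R :=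
  \sum_(I in G) Num.sqrt #|I|%:R * norm2 (subvec I w).

End Norms.

Section ExtendedRealFunctions.
Context {R : realType}.

(* The bound is a real number: in \bar R, -oo bounds everything. *)
Definition bounded_below T (f : T -> \bar R) : Prop :=
  exists c : R, forall x, (c%:E <= f x)%E.

Definition proper_fun T (f : T -> \bar R) : Prop :=
  (forall x, f x != -oo%E) /\ (exists x, f x \is a fin_num).

(* The filter of the limits "as the norm of x tends to infinity". *)
Definition norm2_pinfty {n} : set_system 'cV[R]_n :=
  filter_from [set: R] (fun r => [set x | r < norm2 x]).

Definition coercive n (f : 'cV[R]_n -> \bar R) : Prop :=
  f x @[x --> norm2_pinfty] --> +oo%E.

End ExtendedRealFunctions.

Section SeedFunctions.
Context {R : realType} {m : nat}.

Definition h_LOP (u s : R) : \bar R :=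
  if 0 < s then (u ^+ 2 / (2 * s) + s / 2)%:E
  else if (u == 0) && (s == 0) then 0%E
  else +oo%E.

Definition iota_B1 p (alpha : R) (xi : 'cV[R]_p) : \bar R :=
  if norm1 xi <= alpha then 0%E else +oo%E.

(* The rows are indexed by the enumeration of the set N of neighbouring
   pairs; diff_mxE gives the action on vectors. *)
Definition diff_mx (N : {set 'I_m * 'I_m}) : 'M[R]_(#|N|, m) :=
  \matrix_(k, j) ((j == (enum_val k).1)%:R - (j == (enum_val k).2)%:R).

Lemma diff_mxE (N : {set 'I_m * 'I_m}) (s : 'cV[R]_m) k :
  (diff_mx N *m s) k 0 = s (enum_val k).1 0 - s (enum_val k).2 0.
Proof.
have pick (a : 'I_m) : \sum_j (j == a)%:R * s j 0 = s a 0.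
  rewrite (bigD1 a) //= eqxx mul1r big1 ?addr0 // => j /negbTE ->.
  by rewrite mul0r.
rewrite mxE; under eq_bigr do rewrite mxE mulrBl.
by rewrite sumrB !pick.
Qed.

Definition phi_LOP (N : {set 'I_m * 'I_m}) (alpha : R) (u s : 'cV[R]_m) :
    \bar R :=
  (\sum_(i < m) h_LOP (u i 0%R) (s i 0%R) + iota_B1 alpha (diff_mx N *m s))%E.

Definition phi_TGV p (Dt : 'M[R]_(p, m)) (G1 : {set {set 'I_m}})
    (G2 : {set {set 'I_p}}) (alpha : R) (u s : 'cV[R]_m) : \bar R :=
  (alpha * group_norm G1 (u - s)
   + (1 - alpha) * group_norm G2 (Dt *m s))%:E.

End SeedFunctions.

(* Main.v *)
Require Import Defs.
From mathcomp Require Import all_boot all_order all_algebra.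
From mathcomp Require Import all_classical all_reals all_analysis.
From mathcomp Require Import lra.

Import Order.TTheory GRing.Theory Num.Theory.
Import numFieldNormedType.Exports.

Local Open Scope ring_scope.

(** Both seed functions dominate an affine function of the 1-norm of sigma with
    positive slope, and the 1-norm dominates the 2-norm.  For LOP this is
    [h(u, sigma) >= |sigma| / 2].  For TGV, Cauchy-Schwarz on each block gives
    [sqrt |I| * ||w_I||_2 >= ||w_I||_1], so the group norm of [u - sigma] is at
    least [||u - sigma||_1 >= ||sigma||_1 - ||u||_1]. *)

Section Norms.
Context {R : realType}.

Lemma norm1_ge0 n (x : 'cV[R]_n) : 0 <= norm1 x.
Proof. exact: sumr_ge0. Qed.

Lemma norm1_triangle n (u s : 'cV[R]_n) : norm1 s <= norm1 u + norm1 (u - s).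
Proof.
rewrite -big_split /=; apply: ler_sum => i _.
rewrite !mxE -[X in `|X|](subKr (u i 0)); exact: ler_normB.
Qed.

Lemma norm2_le_norm1 n (x : 'cV[R]_n) : norm2 x <= norm1 x.
Proof.
rewrite -(ger0_norm (norm1_ge0 _ x)) -sqrtr_sqr ler_wsqrtr // expr2 mulr_suml.
(* The square of [norm1 x] is expanded as a sum of [|x_i| * norm1 x], and each [|x_i|] is at most
   [norm1 x]. *)
apply: ler_sum => i _; rewrite -real_normK ?num_real // expr2 ler_wpM2l //.
by rewrite /norm1 (bigD1 i) //= lerDl sumr_ge0.
Qed.

Lemma norm1_le_sqrt_norm2 n (x : 'cV[R]_n) :
  norm1 x <= Num.sqrt n%:R * norm2 x.
Proof.
rewrite -(ger0_norm (norm1_ge0 _ x)) -sqrtr_sqr -sqrtrM ?ler0n // ler_wsqrtr //.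
(* Symmetrizing into a double sum allows a termwise comparison with the expanded square of
   [norm1 x]: each pair (i, j) needs only the inequality of arithmetic and geometric means. *)
have -> : n%:R * (\sum_i x i 0 ^+ 2) =
    \sum_(i < n) \sum_(j < n) (x i 0 ^+ 2 + x j 0 ^+ 2) / 2.
  under [RHS]eq_bigr do rewrite -mulr_suml big_split /= sumr_const card_ord.
  rewrite -mulr_suml big_split /= sumr_const card_ord sumrMnl -mulr_natl; lra.
rewrite expr2 mulr_suml; apply: ler_sum => i _.
rewrite mulr_sumr; apply: ler_sum => j _.
rewrite -(real_normK (num_real (x i 0))) -(real_normK (num_real (x j 0))).
have := sqr_ge0 (`|x i 0| - `|x j 0|); nra.
Qed.

Lemma group_norm_ge0 n (G : {set {set 'I_n}}) (w : 'cV[R]_n) :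
  0 <= group_norm G w.
Proof. by apply: sumr_ge0 => I _; rewrite mulr_ge0 ?sqrtr_ge0. Qed.

Lemma norm1_le_group_norm n (G : {set {set 'I_n}}) (w : 'cV[R]_n) :
  finset.partition G [set: 'I_n]%SET -> norm1 w <= group_norm G w.
Proof.
case/and3P => /eqP covG trivG _.
have -> : norm1 w = \sum_(i in finset.cover G) `|w i 0|.
  by apply: eq_bigl => i; rewrite covG finset.in_setT.
rewrite finset.big_trivIset //=; apply: ler_sum => I _.
apply: le_trans (norm1_le_sqrt_norm2 _ _); rewrite big_enum_val.
by apply: ler_sum => k _; rewrite mxE.
Qed.

End Norms.

Lemma coercive_ge_norm1 (R : realType) n (f : 'cV[R]_n -> \bar R) (a b : R) :
  0 < a -> (forall x, ((a * norm1 x - b)%:E <= f x)%E) -> coercive f.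
Proof.
(* The radius [(M + b) / a] is where the affine minorant [a * r - b] reaches the level [M]. *)
move=> a0 fge A [M [_ MA]]; exists ((M + b) / a) => // x /= xr.
apply/MA/(lt_le_trans _ (fge x)); rewrite lte_fin ltrBrDr.
by rewrite -ltr_pdivrMl // mulrC (lt_le_trans xr) ?norm2_le_norm1.
Qed.

Section LOP.
Context {R : realType} {m : nat}.

Lemma h_LOP_ge (u s : R) : ((2^-1 * `|s|)%:E <= h_LOP u s)%E.
Proof.
rewrite /h_LOP; case: ifPn => [s0|_].
  rewrite lee_fin gtr0_norm // mulrC lerDr.
  by rewrite divr_ge0 ?sqr_ge0 ?mulr_ge0 // ltW.
by case: ifPn => [/andP[_ /eqP->]|_]; rewrite ?normr0 ?mulr0 ?leey.
Qed.

Lemma phi_LOP_ge (N : {set 'I_m * 'I_m}) (alpha : R) (u s : 'cV[R]_m) :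
  ((2^-1 * norm1 s)%:E <= phi_LOP N alpha u s)%E.
Proof.
rewrite -[leLHS]adde0 /phi_LOP leeD //; last by rewrite /iota_B1; case: ifP.
by rewrite mulr_sumr -sumEFin lee_sum // => i _; apply: h_LOP_ge.
Qed.

(** The difference operator kills constants, so the ball constraint holds even for [alpha = 0];
    positive entries keep [h_LOP] in its finite branch whatever [u] is. *)
Lemma phi_LOP_const1_fin_num (N : {set 'I_m * 'I_m}) (alpha : R)
    (u : 'cV[R]_m) :
  0 <= alpha -> phi_LOP N alpha u (const_mx 1) \is a fin_num.
Proof.
move=> alpha0; rewrite /phi_LOP.
under eq_bigr do rewrite /h_LOP mxE ltr01.
have -> : diff_mx N *m const_mx 1 = 0 :> 'cV[R]__.
  by apply/colP => k; rewrite diff_mxE !mxE subrr.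
have -> : iota_B1 alpha (0 : 'cV[R]_#|N|) = 0%E.
  rewrite /iota_B1 /norm1 big1 ?alpha0 // => i _.
  by rewrite mxE normr0.
by rewrite adde0 sumEFin.
Qed.

End LOP.

(** The [G2] term is nonnegative because [alpha <= 1], so the [G1] term alone gives the bound. *)
Lemma phi_TGV_ge (R : realType) m p (Dt : 'M[R]_(p, m)) (G1 : {set {set 'I_m}})
    (G2 : {set {set 'I_p}}) (alpha : R) (u s : 'cV[R]_m) :
  finset.partition G1 [set: 'I_m]%SET -> 0 <= alpha <= 1 ->
  ((alpha * norm1 s - alpha * norm1 u)%:E <= phi_TGV Dt G1 G2 alpha u s)%E.
Proof.
move=> G1P /andP[alpha0 alpha1]; rewrite lee_fin -mulrBr.
rewrite (@le_trans _ _ (alpha * group_norm G1 (u - s))) //.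
  by rewrite ler_wpM2l // (le_trans _ (norm1_le_group_norm _ _ _ _)) // lerBlDl
    norm1_triangle.
by rewrite lerDl mulr_ge0 ?subr_ge0 ?group_norm_ge0.
Qed.

Theorem mainTheorem3 (R : realType) (m : nat) :
  (forall (N : {set 'I_m * 'I_m}) (alpha : R),
     0 <= alpha ->
     bounded_below
       (fun us : 'cV[R]_m * 'cV[R]_m => phi_LOP N alpha us.1 us.2) /\
     (forall u : 'cV[R]_m,
        proper_fun (phi_LOP N alpha u) /\ coercive (phi_LOP N alpha u)))
  /\
  (forall (p : nat) (Dt : 'M[R]_(p, m))
          (G1 : {set {set 'I_m}}) (G2 : {set {set 'I_p}}) (alpha : R),
     finset.partition G1 [set: 'I_m]%SET ->
     finset.partition G2 [set: 'I_p]%SET ->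
     0 < alpha < 1 ->
     bounded_below
       (fun us : 'cV[R]_m * 'cV[R]_m =>
          phi_TGV Dt G1 G2 alpha us.1 us.2) /\
     (forall u : 'cV[R]_m,
        proper_fun (phi_TGV Dt G1 G2 alpha u) /\
        coercive (phi_TGV Dt G1 G2 alpha u))).
Proof.
split=> [N alpha alpha0|p Dt G1 G2 alpha G1P _ /andP[alpha0 alpha1]].
  have LOP0 u s : (0 <= phi_LOP N alpha u s)%E.
    by apply: le_trans (phi_LOP_ge _ _ _ _); rewrite lee_fin mulr_ge0 ?norm1_ge0.
  split=> [|u]; first by exists 0 => us.
  split.
    split=> [s|]; first by rewrite gt_eqF // (lt_le_trans _ (LOP0 u s)).
    by exists (const_mx 1); apply: phi_LOP_const1_fin_num.
  apply: (@coercive_ge_norm1 _ _ _ 2^-1 0) => // s.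
  by rewrite subr0 phi_LOP_ge.
split=> [|u].
  (* The affine minorant depends on [u], so the uniform bound comes instead from the nonnegativity
     of both group norms. *)
  exists 0 => us; rewrite lee_fin addr_ge0 // mulr_ge0 ?group_norm_ge0 //.
    exact: ltW.
  by rewrite subr_ge0 ltW.
split; first by split=> //; exists 0.
(* Here [u] is fixed, so the offset may depend on it. *)
apply: (@coercive_ge_norm1 _ _ _ alpha (alpha * norm1 u)) => // s.
by apply: phi_TGV_ge; rewrite // !ltW.
Qed.
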